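(* Let $\mathcal{X}\subseteq\mathbb{R}^n$, let $g\in\mathbb{R}^{n\times m}$ be a constant matrix, and suppose that the subspace $\{v\in\mathbb{R}^n: v^\top g=0\}$ has dimension $r$ with basis $v_1,\dots,v_r$. For all $i,j\in\{1,\dots,n\}$ and $\ell\in\{1,\dots,r\}$ let $K_{ij}:\mathbb{R}\to\mathbb{R}$ and $\beta_{\ell,ij}:\mathbb{R}\to\mathbb{R}$ be continuously differentiable functions (given by neural networks), and define the matrix-valued function $\Gamma_\phi:\mathcal{X}\to\mathbb{R}^{n\times n}$ entrywise by $$\Gamma_{\phi,ij}(x):=K_{ij}\Big(\sum_{\ell=1}^r\beta_{\ell,ij}\big(x^\top v_\ell\big)\Big).$$ Let $\epsilon>0$ and $M_\phi(x):=\Gamma_\phi(x)^\top\Gamma_\phi(x)+\epsilon I$. Then for all $i,j\in\{1,\dots,n\}$ and all $x\in\mathcal{X}$, $$\big(\partial_x M_{\phi,ij}(x)\big)^\top g=0 .$$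
   Context: $\partial_x M_{\phi,ij}(x)\in\mathbb{R}^n$ denotes the gradient (column vector) of the scalar function $x\mapsto M_{\phi,ij}(x)$, the $(i,j)$ entry of $M_\phi(x)$; thus $(\partial_xM_{\phi,ij}(x))^\top g$ is a row vector in $\mathbb{R}^{1\times m}$. The formula for $\Gamma_\phi$ makes sense on all of $\mathbb{R}^n$, so derivatives at points of $\mathcal{X}$ are those of this extension. The subscript $\phi$ collects the trainable parameters of the networks $K_{ij},\beta_{\ell,ij}$; the only property of these networks being used is that they are continuously differentiable. *)

(* Defs.v *)
From HB Require Import structures.
From mathcomp Require Import all_boot all_order all_algebra.
From mathcomp Require Import boolp classical_sets functions reals.
From mathcomp Require Import topology normedtype derive.

Set Implicit Arguments.
Unset Strict Implicit.
Unset Printing Implicit Defensive.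

Import Order.TTheory GRing.Theory Num.Theory.
Import numFieldNormedType.Exports.

Local Open Scope classical_set_scope.
Local Open Scope ring_scope.

Definition left_null (R : realType) (n m : nat) (g : 'M[R]_(n, m)) :
    {vspace 'cV[R]_n} :=
  lker (linfun (mulmxr g \o @trmx R n 1)).

Lemma mem_left_null (R : realType) (n m : nat) (g : 'M[R]_(n, m))
    (w : 'cV[R]_n) : (w \in left_null g) = (w^T *m g == 0).
Proof. by rewrite memv_ker lfunE. Qed.

Definition continuously_differentiable (R : realType) (f : R -> R) : Prop :=
  (forall t : R, derivable f t 1) /\ continuous (derive1 f).

(* 'D_v f x is a junk value when the limit does not exist, so this is the
   gradient only at points where f is differentiable. *)
Definition gradient (R : realType) (n : nat) (f : 'cV[R]_n -> R)
    (x : 'cV[R]_n) : 'cV[R]_n :=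
  \col_(k < n) 'D_(delta_mx k 0) f x.

Definition Gamma (R : realType) (n r : nat) (v : r.-tuple 'cV[R]_n)
    (K : 'I_n -> 'I_n -> R -> R) (beta : 'I_r -> 'I_n -> 'I_n -> R -> R)
    (x : 'cV[R]_n) : 'M[R]_n :=
  \matrix_(i < n, j < n)
    K i j (\sum_(l < r) beta l i j ((x^T *m tnth v l) 0 0)).

Definition Mphi (R : realType) (n r : nat) (v : r.-tuple 'cV[R]_n)
    (K : 'I_n -> 'I_n -> R -> R) (beta : 'I_r -> 'I_n -> 'I_n -> R -> R)
    (eps : R) (x : 'cV[R]_n) : 'M[R]_n :=
  (Gamma v K beta x)^T *m Gamma v K beta x + eps%:M.

(* Main.v *)
(** Entry [k] of [(gradient f)^T *m g] is the derivative of [f] along the [k]-th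
    column of [g].  That column is orthogonal to every [v_l], so all the inner
    products [x^T v_l], hence [Gamma] and [Mphi], are constant along it. *)

Require Import Defs.
From HB Require Import structures.
From mathcomp Require Import all_boot all_order all_algebra.
From mathcomp Require Import boolp classical_sets functions reals.
From mathcomp Require Import topology normedtype derive.

Set Implicit Arguments.
Unset Strict Implicit.
Unset Printing Implicit Defensive.

Import Order.TTheory GRing.Theory Num.Theory.
Import numFieldNormedType.Exports.

Local Open Scope classical_set_scope.
Local Open Scope ring_scope.

(** The difference quotient is identically zero, so its limit is that of a constant. The argument
    [t *: u + x] has the shape that occurs in the quotient defining ['D_u f x]. *)
Lemma derive_eq0_invariant (R : realType) (V W : normedModType R) (f : V -> W)
    (x u : V) : (forall t : R, f (t *: u + x) = f x) -> 'D_u f x = 0.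
Proof.
move=> fu; rewrite /derive [X in X @ _](_ : _ = cst 0) ?lim_cst//.
by apply/funext => t /=; rewrite fu subrr scaler0.
Qed.

(** Differentiability makes ['D_u f x] linear in [u]; expanding the column in the standard basis
    then produces the partial derivatives. *)
Lemma trmx_gradient_mul (R : realType) (n m : nat) (f : 'cV[R]_n -> R)
    (x : 'cV[R]_n) (g : 'M[R]_(n, m)) (k : 'I_m) :
  differentiable f x -> ((gradient f x)^T *m g) 0 k = 'D_(col k g) f x.
Proof.
move=> df; rewrite mxE deriveE//.
have -> : col k g = \sum_(i < n) g i k *: delta_mx i 0.
  rewrite [LHS]matrix_sum_delta; apply: eq_bigr => i _.
  by rewrite big_ord1 mxE.
rewrite linear_sum; apply: eq_bigr => i _.
by rewrite !mxE linearZ deriveE// mulrC.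
Qed.

Lemma differentiable_tr_mul (R : realType) (n : nat) (w x : 'cV[R]_n) :
  differentiable (fun y : 'cV[R]_n => (y^T *m w) 0 0) x.
Proof.
have -> : (fun y : 'cV[R]_n => (y^T *m w) 0 0) =
    \sum_(k < n) (fun y : 'cV[R]_n => y k 0 * w k 0).
  apply/funext => y; rewrite mxE fct_sumE; apply: eq_bigr => k _.
  by rewrite mxE.
apply: differentiable_sum => k.
apply: differentiableM; first exact: differentiable_coord.
exact: differentiable_cst.
Qed.

Lemma differentiable_Gamma (R : realType) (n r : nat) (v : r.-tuple 'cV[R]_n)
    (K : 'I_n -> 'I_n -> R -> R) (beta : 'I_r -> 'I_n -> 'I_n -> R -> R)
    (hK : forall i j, continuously_differentiable (K i j))
    (hbeta : forall l i j, continuously_differentiable (beta l i j))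
    (i j : 'I_n) (x : 'cV[R]_n) :
  differentiable (fun y => Gamma v K beta y i j) x.
Proof.
have -> : (fun y => Gamma v K beta y i j) =
    K i j \o \sum_(l < r) (beta l i j \o
      (fun y : 'cV[R]_n => (y^T *m tnth v l) 0 0)).
  by apply/funext => y; rewrite mxE /= fct_sumE.
(* The chain rule is stated for [differentiable]; in one variable this is equivalent to [derivable]
   in direction 1. *)
apply: differentiable_comp; last by apply/derivable1_diffP/(hK i j).1.
apply: differentiable_sum => l.
apply: differentiable_comp; first exact: differentiable_tr_mul.
by apply/derivable1_diffP/(hbeta l i j).1.
Qed.

Lemma differentiable_Mphi (R : realType) (n r : nat) (v : r.-tuple 'cV[R]_n)
    (K : 'I_n -> 'I_n -> R -> R) (beta : 'I_r -> 'I_n -> 'I_n -> R -> R)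
    (hK : forall i j, continuously_differentiable (K i j))
    (hbeta : forall l i j, continuously_differentiable (beta l i j))
    (eps : R) (i j : 'I_n) (x : 'cV[R]_n) :
  differentiable (fun y => Mphi v K beta eps y i j) x.
Proof.
(* Written as a function-level sum of products of entries of [Gamma] plus a constant, so that the
   sum and product rules apply. *)
have -> : (fun y => Mphi v K beta eps y i j) =
    \sum_(k < n) ((fun y => Gamma v K beta y k i) *
                  (fun y => Gamma v K beta y k j)) + cst ((eps%:M : 'M_n) i j).
  apply/funext => y; rewrite !fctE fct_sumE !mxE; congr (_ + _).
  by apply: eq_bigr => k _; rewrite mxE.
apply: differentiableD; last exact: differentiable_cst.
by apply: differentiable_sum => k; apply: differentiableM;
  exact: differentiable_Gamma.
Qed.

Lemma Gamma_translate (R : realType) (n r : nat) (v : r.-tuple 'cV[R]_n)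
    (K : 'I_n -> 'I_n -> R -> R) (beta : 'I_r -> 'I_n -> 'I_n -> R -> R)
    (u x : 'cV[R]_n) (hu : forall l, (tnth v l)^T *m u = 0) (t : R) :
  Gamma v K beta (t *: u + x) = Gamma v K beta x.
Proof.
apply/matrixP => i j; rewrite !mxE; congr (K i j _).
apply: eq_bigr => l _; congr (beta l i j (_ 0 0)).
(* The extra term is [t] times [u^T *m tnth v l], the transpose of the product that [hu] makes
   zero. *)
rewrite linearP /= mulmxDl -scalemxAl -[u^T *m _]trmxK trmx_mul trmxK hu.
by rewrite trmx0 scaler0 add0r.
Qed.

(** The differentiability conjunct guarantees that [gradient] is the true gradient here, not a
    vector of default values. *)
Theorem proposition1 (R : realType) (n m r : nat) (X : set 'cV[R]_n)
    (g : 'M[R]_(n, m)) (v : r.-tuple 'cV[R]_n)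
    (hdim : \dim (left_null g) = r)
    (hbasis : basis_of (left_null g) v)
    (K : 'I_n -> 'I_n -> R -> R) (beta : 'I_r -> 'I_n -> 'I_n -> R -> R)
    (hK : forall i j, continuously_differentiable (K i j))
    (hbeta : forall l i j, continuously_differentiable (beta l i j))
    (eps : R) (heps : 0 < eps) :
  forall (i j : 'I_n) (x : 'cV[R]_n), X x ->
    differentiable (fun y => Mphi v K beta eps y i j) x /\
    (gradient (fun y => Mphi v K beta eps y i j) x)^T *m g = 0.
Proof.
move=> i j x _; have dM := differentiable_Mphi v hK hbeta eps i j x.
split=> //; apply/rowP => k; rewrite trmx_gradient_mul// mxE.
apply: derive_eq0_invariant => t; rewrite /Mphi Gamma_translate// => l.
(* A basis vector lies in [left_null g], hence annihilates [g] and, by associativity, each of its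
   columns. *)
have /(basis_mem hbasis) : tnth v l \in v by exact: mem_tnth.
by rewrite mem_left_null => /eqP vg; rewrite colE mulmxA vg mul0mx.
Qed.
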